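(* Let $q>0$ be real, $r\in\mathbb{R}\setminus\{0\}$, $N\ge3$ with $N=2n+1$ or $N=2n$, and let $S^{N-1}_q$ be the algebra of the quantum Euclidean sphere with radius parameter $r$. Let $\langle\perp|$ be the row vector with entries in $S^{N-1}_q$ $$\langle\perp|=\tfrac1r\bigl(q^{-\rho_n}x_n,\,q^{-\rho_{n-1}}x_{n-1},\dots,q^{-\rho_1}x_1,\,x_0,\,x_1^*,\dots,x_{n-1}^*,x_n^*\bigr)\quad\text{if }N=2n+1,$$ $$\langle\perp|=\tfrac1r\bigl(q^{-\rho_n}x_n,\,q^{-\rho_{n-1}}x_{n-1},\dots,q^{-\rho_1}x_1,\,x_1^*,\dots,x_{n-1}^*,x_n^*\bigr)\quad\text{if }N=2n,$$ and let $|\perp\rangle=\langle\perp|^*$ be the adjoint column vector. Then $\langle\perp|\perp\rangle=1$, and the matrices $$e_\perp=|\perp\rangle\langle\perp|,\qquad e_{Cot}=\mathbb{I}_N-|\perp\rangle\langle\perp|$$ in $\mathrm{Mat}_N(S^{N-1}_q)$ are self-adjoint idempotents: $e_\perp^2=e_\perp=e_\perp^*$ and $e_{Cot}^2=e_{Cot}=e_{Cot}^*$. Moreover, for every $\lambda\in\mathbb{C}$ with $|\lambda|=1$, their ranks, computed with the character $\tau_\lambda$ of $S^{N-1}_q$, are $$\tau_\lambda(\mathrm{Tr}(e_\perp))=1,\qquad \tau_\lambda(\mathrm{Tr}(e_{Cot}))=N-1.$$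
   Context: For $N=2n+1$ the index set is $\{0,1,\dots,n\}$ and $\rho_i=\tfrac12-i$ for $1\le i\le n$. For $N=2n$ the index set is $\{1,\dots,n\}$ and $\rho_i=1-i$. Set $$r_i^2=\sum_{k=1}^{i}\bigl(q^{-2\rho_k}x_kx_k^*+x_k^*x_k\bigr)+\epsilon\,x_0^2,$$ where $\epsilon=1$ if $N=2n+1$, and the $x_0^2$ term is absent if $N=2n$. The algebra $S^{N-1}_q$ of the quantum Euclidean sphere with radius parameter $r\in\mathbb{R}\setminus\{0\}$ is the unital complex $*$-algebra generated by the $x_i$, $i$ in the index set (with $x_0=x_0^*$ if $N=2n+1$), subject to the relations: (a) $x_ix_j=q\,x_jx_i$ for $i<j$, and $x_i^*x_j=q\,x_jx_i^*$ for $i\ne j$; (b) $[x_1,x_1^*]=(1-q^{-1})\,x_0^2$ if $N=2n+1$, and $[x_1,x_1^*]=0$ if $N=2n$; (c) $[x_i,x_i^*]=\dfrac{1-q^{-2}}{1+q^{-2\rho_{i-1}}}\,r_{i-1}^2$ for $2\le i\le n$; (d) $r_n^2=r^2\cdot 1$. For $\lambda\in\mathbb{C}$, $|\lambda|=1$, $\tau_\lambda:S^{N-1}_q\to\mathbb{C}$ is the one-dimensional $*$-representation (character) with $\tau_\lambda(1)=1$, $\tau_\lambda(x_n)=\dfrac{r}{\sqrt{1+q^{-2\rho_n}}}\lambda$, $\tau_\lambda(x_n^* )=\dfrac{r}{\sqrt{1+q^{-2\rho_n}}}\bar\lambda$, and $\tau_\lambda(x_i)=\tau_\lambda(x_i^*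 )=0$ for all other indices $i<n$. $\mathrm{Tr}$ is the matrix trace (sum of diagonal entries) $\mathrm{Mat}_N(S^{N-1}_q)\to S^{N-1}_q$. The adjoint of a matrix is $(M^* )_{ij}=(M_{ji})^*$, and $\langle\perp|\perp\rangle$ is the product (row times column) of $\langle\perp|$ and $|\perp\rangle$. *)

(* Defs.v *)
From HB Require Import structures.
From mathcomp Require Import all_boot all_order all_algebra.
From mathcomp Require Import generic_quotient complex.
From mathcomp Require Import boolp reals exp.

Set Implicit Arguments.
Unset Strict Implicit.
Unset Printing Implicit Defensive.

Import Order.TTheory GRing.Theory Num.Theory.
Local Open Scope ring_scope.
Local Open Scope quotient_scope.

Local Notation "x %:C" := (real_complex _ x) (format "x %:C") : ring_scope.

(* Unital *-algebras over a field K with conjugation, e.g. K = R[i]. *)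
HB.mixin Record isStarAlgebra (K : numClosedFieldType) A
    of GRing.Algebra K A := {
  star : A -> A;
  starK : involutive star;
  starD : {morph star : a b / a + b};
  starM : {morph star : a b / a * b >-> b * a};
  starZ : forall c a, star (c *: a) = c^* *: star a
}.

#[short(type="starAlgType")]
HB.structure Definition StarAlgebra (K : numClosedFieldType) :=
  {A of isStarAlgebra K A & GRing.Algebra K A}.

Section StarTheory.
Variables (K : numClosedFieldType) (A : starAlgType K).

Lemma star0 : star (0 : A) = 0.
Proof. by rewrite -{1}[0](scale0r 0) starZ conjC0 scale0r. Qed.

Lemma star1 : star (1 : A) = 1.
Proof. by rewrite -{1}[star 1]mulr1 -{2}(starK 1) -starM mulr1 starK. Qed.

End StarTheory.

Section RegularStar.
Variable K : numClosedFieldType.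
HB.instance Definition _ := isStarAlgebra.Build K K^o
  (@conjCK K) (@rmorphD _ _ (@Num.conj K))
  (fun a b : K^o => etrans (rmorphM (@Num.conj K) a b) (mulrC _ _))
  (fun (c : K) (a : K^o) => rmorphM (@Num.conj K) c a).
End RegularStar.

Definition adjmx (K : numClosedFieldType) (A : starAlgType K) (m n : nat)
  (M : 'M[A]_(m, n)) : 'M[A]_(n, m) := \matrix_(i, j) star (M j i).

(* *-algebras given by generators and relations: formal *-polynomials in the
   generators, modulo the smallest congruence that contains the relations and
   satisfies the axioms of unital *-algebras over K. *)
Section Presentation.
Variables (K : numClosedFieldType) (G : Type).

Inductive sterm : Type :=
| TGen of G
| TZero
| TOne
| TAdd of sterm & sterm
| TMul of sterm & sterm
| TScale of K & sterm
| TStar of sterm.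

Fixpoint seval (A : starAlgType K) (f : G -> A) (t : sterm) : A :=
  match t with
  | TGen g => f g
  | TZero => 0
  | TOne => 1
  | TAdd s t => seval f s + seval f t
  | TMul s t => seval f s * seval f t
  | TScale c t => c *: seval f t
  | TStar t => star (seval f t)
  end.

Variable rel : sterm -> sterm -> Prop.

Inductive scong : sterm -> sterm -> Prop :=
| scong_rel s t : rel s t -> scong s t
| scong_refl t : scong t t
| scong_sym s t : scong s t -> scong t s
| scong_trans s t u : scong s t -> scong t u -> scong s u
| scong_add s s' t t' : scong s s' -> scong t t' ->
    scong (TAdd s t) (TAdd s' t')
| scong_mul s s' t t' : scong s s' -> scong t t' ->
    scong (TMul s t) (TMul s' t')
| scong_scale c t t' : scong t t' -> scong (TScale c t) (TScale c t')
| scong_star t t' : scong t t' -> scong (TStar t) (TStar t')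
| scong_addA s t u : scong (TAdd s (TAdd t u)) (TAdd (TAdd s t) u)
| scong_addC s t : scong (TAdd s t) (TAdd t s)
| scong_add0 t : scong (TAdd TZero t) t
| scong_addN t : scong (TAdd (TScale (-1) t) t) TZero
| scong_mulA s t u : scong (TMul s (TMul t u)) (TMul (TMul s t) u)
| scong_mul1l t : scong (TMul TOne t) t
| scong_mul1r t : scong (TMul t TOne) t
| scong_mulDl s t u :
    scong (TMul (TAdd s t) u) (TAdd (TMul s u) (TMul t u))
| scong_mulDr s t u :
    scong (TMul s (TAdd t u)) (TAdd (TMul s t) (TMul s u))
| scong_scaleA a b t : scong (TScale a (TScale b t)) (TScale (a * b) t)
| scong_scale1 t : scong (TScale 1 t) t
| scong_scaleDr a s t :
    scong (TScale a (TAdd s t)) (TAdd (TScale a s) (TScale a t))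
| scong_scaleDl a b t :
    scong (TScale (a + b) t) (TAdd (TScale a t) (TScale b t))
| scong_scaleAl a s t : scong (TScale a (TMul s t)) (TMul (TScale a s) t)
| scong_scaleAr a s t : scong (TScale a (TMul s t)) (TMul s (TScale a t))
| scong_starK t : scong (TStar (TStar t)) t
| scong_starD s t : scong (TStar (TAdd s t)) (TAdd (TStar s) (TStar t))
| scong_starM s t : scong (TStar (TMul s t)) (TMul (TStar t) (TStar s))
| scong_starZ a t : scong (TStar (TScale a t)) (TScale a^* (TStar t)).

Definition respects (A : starAlgType K) (f : G -> A) :=
  forall s t, rel s t -> seval f s = seval f t.

Lemma scong_seval (A : starAlgType K) (f : G -> A) :
  respects f -> forall s t, scong s t -> seval f s = seval f t.
Proof.
move=> hf s t; elim => {s t} //=.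
- by move=> s t u _ -> _ ->.
- by move=> s s' t t' _ -> _ ->.
- by move=> s s' t t' _ -> _ ->.
- by move=> c t t' _ ->.
- by move=> t t' _ ->.
- by move=> *; rewrite addrA.
- by move=> *; rewrite addrC.
- by move=> *; rewrite add0r.
- by move=> *; rewrite scaleN1r addNr.
- by move=> *; rewrite mulrA.
- by move=> *; rewrite mul1r.
- by move=> *; rewrite mulr1.
- by move=> *; rewrite mulrDl.
- by move=> *; rewrite mulrDr.
- by move=> *; rewrite scalerA.
- by move=> *; rewrite scale1r.
- by move=> *; rewrite scalerDr.
- by move=> *; rewrite scalerDl.
- by move=> *; rewrite scalerAl.
- by move=> *; rewrite scalerAr.
- by move=> *; rewrite starK.
- by move=> *; rewrite starD.
- by move=> *; rewrite starM.
- by move=> *; rewrite starZ.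
Qed.

HB.instance Definition _ := gen_eqMixin sterm.
HB.instance Definition _ := gen_choiceMixin sterm.

Definition scongb (s t : sterm) : bool := `[< scong s t >].

Lemma scongb_refl : reflexive scongb.
Proof. by move=> t; apply/asboolP; exact: scong_refl. Qed.
Lemma scongb_sym : symmetric scongb.
Proof. by move=> s t; apply/asboolP/asboolP; exact: scong_sym. Qed.
Lemma scongb_trans : transitive scongb.
Proof.
by move=> t s u /asboolP h /asboolP h'; apply/asboolP; exact: scong_trans h'.
Qed.

Canonical scong_equiv := EquivRel scongb scongb_refl scongb_sym scongb_trans.

Definition presalg := {eq_quot scong_equiv}.
HB.instance Definition _ := Choice.on presalg.

Definition cls (t : sterm) : presalg := \pi_presalg t.

Lemma clsP s t : scong s t -> cls s = cls t.
Proof. by move=> h; apply/eqmodP/asboolP. Qed.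

Lemma cls_inj s t : cls s = cls t -> scong s t.
Proof. by move/eqmodP/asboolP. Qed.

Lemma cls_repr (a : presalg) : cls (repr a) = a.
Proof. exact: reprK. Qed.

Lemma repr_cls t : scong (repr (cls t)) t.
Proof. by apply: cls_inj; rewrite cls_repr. Qed.

Definition pres_add (a b : presalg) := cls (TAdd (repr a) (repr b)).
Definition pres_mul (a b : presalg) := cls (TMul (repr a) (repr b)).
Definition pres_scale c (a : presalg) := cls (TScale c (repr a)).
Definition pres_star (a : presalg) := cls (TStar (repr a)).

Lemma cls_add s t : pres_add (cls s) (cls t) = cls (TAdd s t).
Proof. by apply/clsP/scong_add; exact: repr_cls. Qed.
Lemma cls_mul s t : pres_mul (cls s) (cls t) = cls (TMul s t).
Proof. by apply/clsP/scong_mul; exact: repr_cls. Qed.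
Lemma cls_scale c t : pres_scale c (cls t) = cls (TScale c t).
Proof. by apply/clsP/scong_scale; exact: repr_cls. Qed.
Lemma cls_star t : pres_star (cls t) = cls (TStar t).
Proof. by apply/clsP/scong_star; exact: repr_cls. Qed.

Lemma presW (P : presalg -> Prop) : (forall t, P (cls t)) -> forall a, P a.
Proof. by move=> h a; rewrite -(cls_repr a). Qed.

Definition pres_simp := (cls_add, cls_mul, cls_scale, cls_star).

Fact pres_addA : associative pres_add.
Proof.
elim/presW=> s; elim/presW=> t; elim/presW=> u.
by rewrite !pres_simp; apply/clsP; exact: scong_addA.
Qed.
Fact pres_addC : commutative pres_add.
Proof.
elim/presW=> s; elim/presW=> t.
by rewrite !pres_simp; apply/clsP; exact: scong_addC.
Qed.
Fact pres_add0 : left_id (cls TZero) pres_add.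
Proof.
by elim/presW=> t; rewrite !pres_simp; apply/clsP; exact: scong_add0.
Qed.
Fact pres_addN : left_inverse (cls TZero) (pres_scale (-1)) pres_add.
Proof.
by elim/presW=> t; rewrite !pres_simp; apply/clsP; exact: scong_addN.
Qed.
HB.instance Definition _ := GRing.isZmodule.Build presalg
  pres_addA pres_addC pres_add0 pres_addN.

Fact pres_mulA : associative pres_mul.
Proof.
elim/presW=> s; elim/presW=> t; elim/presW=> u.
by rewrite !pres_simp; apply/clsP; exact: scong_mulA.
Qed.
Fact pres_mul1l : left_id (cls TOne) pres_mul.
Proof.
by elim/presW=> t; rewrite !pres_simp; apply/clsP; exact: scong_mul1l.
Qed.
Fact pres_mul1r : right_id (cls TOne) pres_mul.
Proof.
by elim/presW=> t; rewrite !pres_simp; apply/clsP; exact: scong_mul1r.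
Qed.
Fact pres_mulDl : left_distributive pres_mul pres_add.
Proof.
elim/presW=> s; elim/presW=> t; elim/presW=> u.
by rewrite !pres_simp; apply/clsP; exact: scong_mulDl.
Qed.
Fact pres_mulDr : right_distributive pres_mul pres_add.
Proof.
elim/presW=> s; elim/presW=> t; elim/presW=> u.
by rewrite !pres_simp; apply/clsP; exact: scong_mulDr.
Qed.
HB.instance Definition _ := GRing.Zmodule_isPzRing.Build presalg
  pres_mulA pres_mul1l pres_mul1r pres_mulDl pres_mulDr.

Fact pres_scaleA a b v :
  pres_scale a (pres_scale b v) = pres_scale (a * b) v.
Proof.
elim/presW: v => t.
by rewrite !pres_simp; apply/clsP; exact: scong_scaleA.
Qed.
Fact pres_scale1 : left_id 1 pres_scale.
Proof.
by elim/presW=> t; rewrite !pres_simp; apply/clsP; exact: scong_scale1.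
Qed.
Fact pres_scaleDr : right_distributive pres_scale +%R.
Proof.
move=> a; elim/presW=> s; elim/presW=> t.
by rewrite /GRing.add /= !pres_simp; apply/clsP; exact: scong_scaleDr.
Qed.
Fact pres_scaleDl v : {morph pres_scale^~ v : a b / a + b}.
Proof.
move=> a b; elim/presW: v => t.
by rewrite [RHS]/GRing.add /= !pres_simp; apply/clsP; exact: scong_scaleDl.
Qed.
HB.instance Definition _ := GRing.Zmodule_isLmodule.Build K presalg
  pres_scaleA pres_scale1 pres_scaleDr pres_scaleDl.

Fact pres_scaleAl a (u v : presalg) : a *: (u * v) = (a *: u) * v.
Proof.
elim/presW: u => s; elim/presW: v => t.
rewrite /GRing.mul /GRing.scale /= !pres_simp; apply/clsP.
exact: scong_scaleAl.
Qed.
Fact pres_scaleAr a (u v : presalg) : a *: (u * v) = u * (a *: v).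
Proof.
elim/presW: u => s; elim/presW: v => t.
rewrite /GRing.mul /GRing.scale /= !pres_simp; apply/clsP.
exact: scong_scaleAr.
Qed.
Fact pres_starK : involutive pres_star.
Proof.
by elim/presW=> t; rewrite !pres_simp; apply/clsP; exact: scong_starK.
Qed.
Fact pres_starD : {morph pres_star : a b / a + b}.
Proof.
elim/presW=> s; elim/presW=> t.
by rewrite /GRing.add /= !pres_simp; apply/clsP; exact: scong_starD.
Qed.
Fact pres_starM : {morph pres_star : a b / a * b >-> b * a}.
Proof.
elim/presW=> s; elim/presW=> t.
by rewrite /GRing.mul /= !pres_simp; apply/clsP; exact: scong_starM.
Qed.
Fact pres_starZ c a : pres_star (c *: a) = c^* *: pres_star a.
Proof.
elim/presW: a => t.
by rewrite /GRing.scale /= !pres_simp; apply/clsP; exact: scong_starZ.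
Qed.

Lemma pres_nontrivial (A : starAlgType K) (f : G -> A) :
  respects f -> (1 : presalg) != 0.
Proof.
move=> hf; apply/eqP => /cls_inj /(scong_seval hf) /eqP.
by rewrite oner_eq0.
Qed.

End Presentation.

Arguments TZero {K G}.
Arguments TOne {K G}.
Arguments TGen {K G}.

Declare Scope sterm_scope.
Delimit Scope sterm_scope with T.
Bind Scope sterm_scope with sterm.
Notation "0" := TZero : sterm_scope.
Notation "1" := TOne : sterm_scope.
Notation "s + t" := (TAdd s t) : sterm_scope.
Notation "s * t" := (TMul s t) : sterm_scope.
Notation "c *: t" := (TScale c%R t) : sterm_scope.
Notation "s - t" := (TAdd s (TScale (-1)%R t)) : sterm_scope.
Notation "t ^*" := (TStar t) : sterm_scope.

Section QuantumSphere.
Variables (R : realType) (q r : R) (N : nat).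
Let n := N./2.

Definition rho (i : nat) : R := if odd N then 1 / 2 - i%:R else 1 - i%:R.

(* {0, .., n} if N = 2n + 1 and {1, .., n} if N = 2n *)
Definition qs_index := {k : nat | (~~ odd N <= k <= n)%N}.

Local Notation term := (sterm R[i] qs_index).

(* junk value 0 when k is not in the index set *)
Definition tx (k : nat) : term := if insub k is Some g then TGen g else TZero.

(* the element r_i^2 *)
Definition trsq (i : nat) : term :=
  (\big[@TAdd _ _/0]_(1 <= k < i.+1)
     ((q `^ (- 2 * rho k))%:C *: (tx k * (tx k)^*) + (tx k)^* * tx k)
   + (if odd N then tx 0 * tx 0 else 0))%T.

Local Notation is_index k := (~~ odd N <= k <= n)%N.

Inductive qs_rel : term -> term -> Prop :=
| qs_x0 : odd N -> qs_rel (tx 0)^* (tx 0)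
| qs_xx i j : is_index i -> is_index j -> (i < j)%N ->
    qs_rel (tx i * tx j) (q%:C *: (tx j * tx i))
| qs_xsx i j : is_index i -> is_index j -> i != j ->
    qs_rel ((tx i)^* * tx j) (q%:C *: (tx j * (tx i)^*))
| qs_comm1_odd : odd N ->
    qs_rel (tx 1 * (tx 1)^* - (tx 1)^* * tx 1)
           ((1 - q^-1)%:C *: (tx 0 * tx 0))
| qs_comm1_even : ~~ odd N ->
    qs_rel (tx 1 * (tx 1)^* - (tx 1)^* * tx 1) 0
| qs_comm i : (2 <= i <= n)%N ->
    qs_rel (tx i * (tx i)^* - (tx i)^* * tx i)
           (((1 - q ^- 2) / (1 + q `^ (- 2 * rho i.-1)))%:C *: trsq i.-1)
| qs_radius : qs_rel (trsq n) ((r ^+ 2)%:C *: 1).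

Definition tau_coef : R := r / Num.sqrt (1 + q `^ (- 2 * rho n)).

Definition tau_gen (lam : R[i]) (g : qs_index) : R[i]^o :=
  if val g == n then tau_coef%:C * lam else 0.


Hypothesis hN : (2 < N)%N.

Lemma is_index_top : is_index n.
Proof.
by rewrite leqnn andbT; case: odd => //=; rewrite half_gt0 (ltnW hN).
Qed.

Lemma index_gt0 : (0 < n)%N.
Proof. by rewrite half_gt0 (ltnW hN). Qed.

Lemma seval_tau_tx lam k :
  seval (tau_gen lam) (tx k) = if k == n then tau_coef%:C * lam else 0.
Proof.
rewrite /tx; case: insubP => [g _ <-//|]; case: eqP => [->|//].
by rewrite is_index_top.
Qed.

Lemma seval_trsq (A : starAlgType R[i]) (f : qs_index -> A) i :
  seval f (trsq i) =
  \sum_(1 <= k < i.+1)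
     ((q `^ (- 2 * rho k))%:C *: (seval f (tx k) * star (seval f (tx k)))
      + star (seval f (tx k)) * seval f (tx k))
  + (if odd N then seval f (tx 0) * seval f (tx 0) else 0).
Proof.
rewrite /trsq /=; congr (_ + _); last by case: odd.
exact: (big_morph (seval f) (id1 := 0) (op1 := +%R)).
Qed.

Lemma seval_tau_trsq lam i : (i < n)%N -> seval (tau_gen lam) (trsq i) = 0.
Proof.
move=> lt_in; have H k : (k < n)%N -> seval (tau_gen lam) (tx k) = 0.
  by move=> lt_kn; rewrite seval_tau_tx ltn_eqF.
rewrite seval_trsq big_nat big1 ?add0r => [|k /andP[_ lt_ki]].
  by case: odd; rewrite // H ?index_gt0 // mul0r.
by rewrite H ?(leq_trans lt_ki) // star0 mulr0 scaler0 addr0.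
Qed.

Lemma tau_respects lam : `|lam| = 1 -> respects qs_rel (tau_gen lam).
Proof.
move=> lam1 s t; case=> {s t}.
- move=> oN; rewrite /= seval_tau_tx ltn_eqF ?index_gt0 //.
  exact: star0.
- move=> i j _ /andP[_ le_jn] lt_ij; rewrite /= (seval_tau_tx _ i).
  by rewrite ltn_eqF ?(leq_trans lt_ij) // mul0r mulr0 scaler0.
- move=> i j _ _ neq_ij; rewrite /= !seval_tau_tx.
  case: (altP (i =P n)) => [i_n|_].
    by rewrite -i_n eq_sym (negbTE neq_ij) mulr0 mul0r scaler0.
  by rewrite star0 mul0r mulr0 scaler0.
- move=> oN; rewrite /= (seval_tau_tx _ 0) (ltn_eqF index_gt0) mul0r scaler0.
  by rewrite scaleN1r mulrC subrr.
- by move=> _; rewrite /= scaleN1r mulrC subrr.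
- move=> i /andP[i_ge2 le_in].
  rewrite [LHS]/= -[RHS]/(_ *: seval _ (trsq i.-1)).
  rewrite seval_tau_trsq; last by case: i i_ge2 le_in.
  by rewrite scaler0 scaleN1r mulrC subrr.
- rewrite seval_trsq big_nat_recr ?index_gt0 //= big_nat big1 ?add0r; last first.
    move=> k /andP[_ lt_kn]; rewrite seval_tau_tx ltn_eqF //.
    by rewrite star0 mulr0 scaler0 addr0.
  rewrite !(seval_tau_tx _ 0) (ltn_eqF index_gt0) mul0r if_same addr0.
  rewrite seval_tau_tx eqxx.
  set c := 1 + q `^ (- 2 * rho n).
  have c_gt0 : 0 < c by rewrite ltr_wpDr ?powR_ge0.
  set z : R[i] := tau_coef%:C * lam.
  have zz : z * z^* = (r ^+ 2 / c)%:C.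
    rewrite -normCK normrM lam1 mulr1 normc_def /= expr0n addr0 sqrtr_sqr.
    rewrite -rmorphXn /= real_normK ?num_real // expr_div_n.
    by rewrite sqr_sqrtr ?ltW.
  rewrite /star /=.
  rewrite (mulrC z^* z) zz -[LHS]/(_ * _ + _) -[RHS]/(_ * _).
  rewrite -[X in _ + X]mul1r -mulrDl -(rmorph1 (real_complex R)) -rmorphD -!rmorphM /=.
  by rewrite mulr1 addrC mulrCA divff ?mulr1 ?gt_eqF.
Qed.

(* The bound on N ensures 1 != 0, which the algebra structures require. *)
Definition qsphere (_ : (2 < N)%N) := presalg qs_rel.
Local Notation S := (qsphere hN).

HB.instance Definition _ := GRing.Lmodule.on S.
HB.instance Definition _ := GRing.PzRing.on S.

Fact qsphere_nontrivial : (1 : S) != 0.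
Proof. by apply: pres_nontrivial (tau_respects (lam := 1) _); exact: normr1. Qed.
HB.instance Definition _ :=
  GRing.PzSemiRing_isNonZero.Build S qsphere_nontrivial.
HB.instance Definition _ :=
  GRing.Lmodule_isLalgebra.Build R[i] S (@pres_scaleAl _ _ qs_rel).
HB.instance Definition _ :=
  GRing.Lalgebra_isAlgebra.Build R[i] S (@pres_scaleAr _ _ qs_rel).
HB.instance Definition _ := isStarAlgebra.Build R[i] S
  (@pres_starK _ _ qs_rel) (@pres_starD _ _ qs_rel)
  (@pres_starM _ _ qs_rel) (@pres_starZ _ _ qs_rel).


Definition qsx (k : nat) : S := cls qs_rel (tx k).
Local Notation x := qsx.

Lemma qs_clsE t : cls qs_rel t = seval (fun g => cls qs_rel (TGen g) : S) t.
Proof.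
elim: t => //= [s <- t <-|s <- t <-|c t <-|t <-]; symmetry.
- exact: cls_add.
- exact: cls_mul.
- exact: cls_scale.
- exact: cls_star.
Qed.

Section UniversalProperty.
Variables (B : starAlgType R[i]) (f : qs_index -> B).

Definition qs_lift (_ : respects qs_rel f) (a : S) : B := seval f (repr a).

Hypothesis hf : respects qs_rel f.

Lemma qs_lift_cls t : qs_lift hf (cls qs_rel t) = seval f t.
Proof. exact/(scong_seval hf)/repr_cls. Qed.

Fact qs_lift_zmod_morphism : zmod_morphism (qs_lift hf).
Proof.
elim/presW=> s; elim/presW=> t; rewrite /GRing.opp /GRing.add /=.
by rewrite !pres_simp !qs_lift_cls /= scaleN1r.
Qed.
Fact qs_lift_monoid_morphism : monoid_morphism (qs_lift hf).
Proof.
split; first exact: qs_lift_cls.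
elim/presW=> s; elim/presW=> t; rewrite /GRing.mul /=.
by rewrite !pres_simp !qs_lift_cls.
Qed.
Fact qs_lift_scalable : scalable (qs_lift hf).
Proof.
move=> a; elim/presW=> t; rewrite /GRing.scale /=.
by rewrite !pres_simp !qs_lift_cls.
Qed.
HB.instance Definition _ :=
  GRing.isZmodMorphism.Build S B (qs_lift hf) qs_lift_zmod_morphism.
HB.instance Definition _ :=
  GRing.isMonoidMorphism.Build S B (qs_lift hf) qs_lift_monoid_morphism.
HB.instance Definition _ :=
  GRing.isScalable.Build R[i] S B *:%R (qs_lift hf) qs_lift_scalable.

Lemma qs_lift_star a : qs_lift hf (star a) = star (qs_lift hf a).
Proof.
by elim/presW: a => t; rewrite /star /= !pres_simp !qs_lift_cls.
Qed.

Lemma qs_lift_unique (phi : {lrmorphism S -> B}) :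
  {morph phi : a / star a} ->
  (forall g, phi (x (val g)) = f g) -> phi =1 qs_lift hf.
Proof.
move=> phi_star phi_x; elim/presW=> t; rewrite qs_lift_cls qs_clsE.
elim: t => /= [g|||s <- t <-|s <- t <-|c t <-|t <-].
- by rewrite -phi_x /qsx /tx valK.
- exact: rmorph0.
- exact: rmorph1.
- exact: rmorphD.
- exact: rmorphM.
- exact: linearZ.
- exact: phi_star.
Qed.

End UniversalProperty.

Section Character.
Variables (lam : R[i]) (lam1 : `|lam| = 1).

(* the *-homomorphism that extends tau_gen *)
Definition tau : {lrmorphism S -> R[i]^o} := qs_lift (tau_respects lam1).

Lemma tau_star a : tau (star a) = (tau a)^*.
Proof. exact: qs_lift_star. Qed.

Lemma tau_xn : tau (x n) = (r / Num.sqrt (1 + q `^ (- 2 * rho n)))%:C * lam.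
Proof. by rewrite /tau /= qs_lift_cls seval_tau_tx eqxx. Qed.

Lemma tau_x k : (k < n)%N -> tau (x k) = 0.
Proof. by move=> lt_kn; rewrite /tau /= qs_lift_cls seval_tau_tx ltn_eqF. Qed.

End Character.

(* the entries of r <perp|, from left to right *)
Definition perp_seq : seq S :=
  [seq (q `^ (- rho k))%:C *: x k | k <- rev (iota 1 n)]
  ++ (if odd N then [:: x 0] else [::])
  ++ [seq star (x k) | k <- iota 1 n].

Lemma size_perp_seq : size perp_seq = N.
Proof.
rewrite !size_cat !size_map size_rev !size_iota addnCA addnn.
rewrite -[RHS]odd_double_half; by case: odd.
Qed.

Definition bra_perp : 'rV[S]_N := \row_(j < N) ((r^-1)%:C *: perp_seq`_j).
Definition ket_perp : 'cV[S]_N := adjmx bra_perp.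
Definition e_perp : 'M[S]_N := ket_perp *m bra_perp.
Definition e_cot : 'M[S]_N := 1%:M - ket_perp *m bra_perp.

End QuantumSphere.

(* Main.v *)
Require Import Defs.
From mathcomp Require Import all_boot all_order all_algebra.
From mathcomp Require Import complex reals.
From mathcomp Require Import exp.

Import GRing.Theory Num.Theory.
Local Open Scope ring_scope.

(** Since [x_0] is self-adjoint, [r^2 <perp|perp>] is exactly the expression
    [r_n^2], so the radius relation is normalization; the projector identities
    are formal consequences. A character takes values in a commutative algebra,
    so it cannot distinguish [Tr |perp><perp|] from [<perp|perp>]. *)

Section AdjointMatrices.
Variables (K : numClosedFieldType) (A : starAlgType K).

Lemma starN : {morph @star K A : a / - a}.
Proof. by move=> a; rewrite -scaleN1r starZ rmorphN rmorph1 scaleN1r. Qed.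

Lemma star_sum (I : Type) (s : seq I) (P : pred I) (F : I -> A) :
  star (\sum_(i <- s | P i) F i) = \sum_(i <- s | P i) star (F i).
Proof. exact: (big_morph (@star K A) (@starD K A) (star0 A)). Qed.

Lemma adjmxK (m n : nat) (M : 'M[A]_(m, n)) : adjmx (adjmx M) = M.
Proof. by apply/matrixP=> i j; rewrite !mxE starK. Qed.

Lemma adjmxB (m n : nat) (M M' : 'M[A]_(m, n)) :
  adjmx (M - M') = adjmx M - adjmx M'.
Proof. by apply/matrixP=> i j; rewrite !mxE starD starN. Qed.

Lemma adjmx1 (n : nat) : adjmx (1%:M : 'M[A]_n) = 1%:M.
Proof.
apply/matrixP=> i j; rewrite !mxE eq_sym.
by case: eqP => _; rewrite ?star1 ?star0.
Qed.

(** Transposition alone does not reverse products over a noncommutative [A]; the order reversal of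
    [star] on entries compensates. *)
Lemma adjmxM (m n p : nat) (M : 'M[A]_(m, n)) (M' : 'M[A]_(n, p)) :
  adjmx (M *m M') = adjmx M' *m adjmx M.
Proof.
apply/matrixP=> i j; rewrite !mxE star_sum.
by apply: eq_bigr => k _; rewrite !mxE starM.
Qed.

End AdjointMatrices.

Lemma comp_mx1_idem (A : pzRingType) (n : nat) (e : 'M[A]_n) :
  e *m e = e -> (1%:M - e) *m (1%:M - e) = 1%:M - e.
Proof.
by move=> ee; rewrite mulmxBl mul1mx mulmxBr mulmx1 ee subrr subr0.
Qed.

Section QuantumSphereNorm.
Variables (R : realType) (q r : R) (N : nat) (hN : (2 < N)%N).
Local Notation n := N./2.
Local Notation S := (qsphere q r hN).
Local Notation x := (qsx q r hN).
Local Notation "c %:C" := (real_complex R c).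

Lemma star_realZ (c : R) (a : S) : star (c%:C *: a) = c%:C *: star a.
Proof. by rewrite starZ; congr (_ *: _); exact: conjc_real. Qed.

Lemma qsx0_star : odd N -> star (x 0%N) = x 0%N.
Proof.
by move=> oN; rewrite [LHS]cls_star; apply/clsP/scong_rel/qs_x0.
Qed.

Lemma qs_radiusE :
  \sum_(1 <= k < n.+1) ((q `^ (- 2 * rho R N k))%:C *: (x k * star (x k))
                        + star (x k) * x k)
  + (if odd N then x 0%N * x 0%N else 0) = (r ^+ 2)%:C *: 1.
Proof.
have := clsP (scong_rel (qs_radius q r N)).
(* The class of a formal term is its evaluation at the generator classes, so the formal sum [trsq]
   becomes a sum in the sphere algebra; the reverse rewriting below restores the [x k]. *)
rewrite !(qs_clsE q r hN) seval_trsq /= => <-.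
congr (_ + _); last by case: (odd N); rewrite // -!(qs_clsE q r hN).
by apply: eq_bigr => k _; rewrite -!(qs_clsE q r hN).
Qed.

Hypothesis hq : 0 < q.

(** The weight of $x_k$ in the bra is a square root of the weight of $x_kx_k^*$ in $r_n^2$.
    Positivity of [q] settles the nonvanishing condition on the base in [powRD]. *)
Lemma powR_rho_sqr (k : nat) :
  (q `^ (- rho R N k))%:C * (q `^ (- rho R N k))%:C
  = (q `^ (- 2 * rho R N k))%:C.
Proof.
rewrite -rmorphM /= -powRD ?lt0r_neq0 ?implybT //.
by rewrite mulNr mulr_natl mulr2n opprD.
Qed.

Lemma sum_perp_seq :
  \sum_(a <- perp_seq q r hN) a * star a = (r ^+ 2)%:C *: 1.
Proof.
rewrite -qs_radiusE /perp_seq !big_cat /= !big_map.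
(* The first block runs through the indices downwards, which does not affect its sum. *)
rewrite (perm_big (iota 1 n)) /=; last by rewrite perm_rev.
(* The middle $x_0$ term moves to the end, as in $r_n^2$, and the blocks are compared one by one. *)
rewrite addrCA addrC big_split /= /index_iota subn1 /=; congr (_ + _ + _).
- apply: eq_bigr => k _.
  by rewrite star_realZ -scalerAl -scalerAr scalerA powR_rho_sqr.
- by apply: eq_bigr => k _; rewrite starK.
- by case: ifP => [oN|_]; rewrite ?big_seq1 ?big_nil ?qsx0_star.
Qed.

Hypothesis hr : r != 0.

Lemma bra_ket_perp : bra_perp q r hN *m ket_perp q r hN = 1%:M.
Proof.
apply/matrixP=> i j; rewrite !ord1 !mxE eqxx.
pose F (a : S) := (r^-1)%:C *: a * star ((r^-1)%:C *: a).
transitivity (\sum_(k < N) F (perp_seq q r hN)`_k).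
  by apply: eq_bigr => k _; rewrite !mxE.
have -> : \sum_(k < N) F (perp_seq q r hN)`_k
        = \sum_(a <- perp_seq q r hN) F a.
  by rewrite (big_nth 0) size_perp_seq big_mkord.
(* The scalar $r^{-1}$ is real, so each product contributes the common factor $r^{-2}$. *)
under eq_bigr => a _ do rewrite /F star_realZ -scalerAl -scalerAr scalerA.
rewrite -scaler_sumr sum_perp_seq scalerA -!rmorphM /=.
by rewrite -expr2 -exprMn mulVf // expr1n scale1r.
Qed.

Lemma e_perp_idem : e_perp q r hN *m e_perp q r hN = e_perp q r hN.
Proof.
by rewrite /e_perp mulmxA -(mulmxA (ket_perp _ _ _)) bra_ket_perp mulmx1.
Qed.

Lemma e_perp_adj : adjmx (e_perp q r hN) = e_perp q r hN.
Proof. by rewrite adjmxM adjmxK. Qed.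

Lemma tau_tr_e_perp (lam : R[i]) (hlam : `|lam| = 1) :
  tau q r hN hlam (\tr (e_perp q r hN)) = 1.
Proof.
have /matrixP/(_ 0 0) := bra_ket_perp; rewrite !mxE eqxx.
move/(congr1 (tau q r hN hlam)); rewrite rmorph1 => <-.
rewrite !rmorph_sum; apply: eq_bigr => k _.
(* A diagonal entry of [e_perp] is a single product, the inner dimension being 1; its factors
   commute after applying [tau]. *)
by rewrite !mxE big_ord1 !mxE !rmorphM; exact: mulrC.
Qed.

End QuantumSphereNorm.

Theorem mainTheorem2 (R : realType) (q r : R) (N : nat) (hN : (3 <= N)%N)
    (hq : 0 < q) (hr : r != 0) :
  bra_perp q r hN *m ket_perp q r hN = 1%:M /\
  (e_perp q r hN *m e_perp q r hN = e_perp q r hN /\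
   e_perp q r hN = adjmx (e_perp q r hN)) /\
  (e_cot q r hN *m e_cot q r hN = e_cot q r hN /\
   e_cot q r hN = adjmx (e_cot q r hN)) /\
  (forall (lam : R[i]) (hlam : `|lam| = 1),
     tau q r hN hlam (\tr (e_perp q r hN)) = 1 /\
     tau q r hN hlam (\tr (e_cot q r hN)) = N%:R - 1).
Proof.
rewrite -[e_cot q r hN]/(1%:M - e_perp q r hN).
split; first exact: bra_ket_perp.
split; first by rewrite e_perp_idem ?e_perp_adj.
split; first by rewrite comp_mx1_idem ?e_perp_idem // adjmxB adjmx1 e_perp_adj.
move=> lam hlam; split; first exact: tau_tr_e_perp.
have -> : \tr (1%:M - e_perp q r hN) = N%:R - \tr (e_perp q r hN).
  by rewrite raddfB /= mxtrace1.
by rewrite rmorphB rmorph_nat; congr (_ - _); exact: tau_tr_e_perp.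
Qed.
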